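(* For a positive integer $m$, let $\mathcal{L}_m$ denote the number of vertices of a longest (simple) path in a Random Apollonian Network with $m$ bounded faces. Then for every positive integer $m$: (a) $\mathcal{L}_m \ge m^{\log 2/\log 3} + 2$ (for every realization of the network); (b) $\mathbb{E}[\mathcal{L}_m] = \Omega(m^{0.88})$.
   Context: A Random Apollonian Network (RAN) is built as follows: start with a triangle embedded in the plane; in each step choose a bounded face uniformly at random (independently of previous choices), add a new vertex inside it and join the new vertex to the three vertices of that face. After $n-3$ steps one obtains a random triangulated plane graph with $n$ vertices and $m=2n-5$ bounded faces. Logarithms are natural. *)

(* Defs.v *)
From mathcomp Require Import all_boot all_order all_algebra.
From mathcomp Require Import all_classical all_reals all_analysis.

Set Implicit Arguments.
Unset Strict Implicit.
Unset Printing Implicit Defensive.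

Import Order.TTheory GRing.Theory Num.Theory.
Import numFieldNormedType.Exports.

(* A plane triangulation, given combinatorially: the vertices are the naturals
   below [nvert], each edge is listed once (in one of its two orientations),
   and a bounded face is the triple of its corners in cyclic order, so that the
   embedding is recorded up to homeomorphism. *)
Record plane_net := PlaneNet {
  nvert : nat;
  edges : seq (nat * nat);
  faces : seq (nat * nat * nat)
}.

Definition triangle : plane_net :=
  PlaneNet 3 [:: (0, 1); (1, 2); (2, 0)] [:: (0, 1, 2)].

(* The bounded face abc is replaced by the three faces abv, bcv and cav, where
   v is a new vertex placed inside it.  The default value of [nth] is never
   reached when i < size (faces G), see [size_faces_ran]. *)
Definition subdivide (G : plane_net) (i : nat) : plane_net :=
  let: (a, b, c) := nth (0, 0, 0) (faces G) i in
  let v := nvert G in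
  PlaneNet v.+1
    [:: (a, v), (b, v), (c, v) & edges G]
    (set_nth (0, 0, 0) (faces G) i (a, b, v) ++ [:: (b, c, v); (c, a, v)]).

(* The face choices of the first k steps: step j (from 0) picks one of the
   j.*2.+1 bounded faces present at that time. *)
Fixpoint history (k : nat) : finType :=
  if k is k'.+1 then (history k' * 'I_(k'.*2.+1))%type else unit.

Fixpoint ran (k : nat) : history k -> plane_net :=
  match k with
  | 0 => fun=> triangle
  | k'.+1 => fun w : history k' * 'I_(k'.*2.+1) => subdivide (ran w.1) w.2
  end.

Lemma nvert_ran k (w : history k) : nvert (ran w) = k.+3.
Proof.
elim: k w => [//|k IHk] [w i] /=; rewrite /subdivide.
by case: nth => [[a b] c] /=; rewrite IHk.
Qed.

Lemma size_faces_ran k (w : history k) : size (faces (ran w)) = k.*2.+1.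
Proof.
elim: k w => [//|k IHk] [w i] /=; rewrite /subdivide.
case: nth => [[a b] c] /=; rewrite size_cat size_set_nth IHk /=.
by rewrite (maxn_idPr (ltn_ord i)) addn2.
Qed.

Definition adj (G : plane_net) : rel 'I_(nvert G) :=
  fun u v => ((val u, val v) \in edges G) || ((val v, val u) \in edges G).

(* Number of vertices of a longest simple path of a finite graph. *)
Definition longest_path (T : finType) (e : rel T) : nat :=
  \max_(l < #|T|.+1 | [exists p : l.-tuple T, uniq p && sorted e p]) l.

(* The number of vertices of a longest path of the network with m = k.*2.+1
   bounded faces. *)
Definition L (k : nat) (w : history k) : nat := longest_path (@adj (ran w)).

Local Open Scope ring_scope.

(* Conditionally on the earlier choices, each of the current bounded faces is
   chosen with the same probability. *)
Fixpoint prob (R : realType) (k : nat) : history k -> R :=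
  match k with
  | 0 => fun=> 1
  | k'.+1 => fun w : history k' * 'I_(k'.*2.+1) =>
      prob R w.1 * (size (faces (ran w.1)))%:R^-1
  end.

Lemma sum_prob (R : realType) k : \sum_(w : history k) prob R w = 1.
Proof.
elim: k => [|k IHk]; first by rewrite (big_pred1 tt) //; case.
rewrite -(pair_bigA _ (fun (w : history k) (i : 'I_(k.*2.+1)) =>
  prob R w * (size (faces (ran w)))%:R^-1)) /= -[RHS]IHk.
apply: eq_bigr => w _; rewrite sumr_const card_ord size_faces_ran.
by rewrite -[LHS]mulr_natr -mulrA mulVf ?mulr1 // pnatr_eq0.
Qed.

Definition expect (R : realType) (k : nat) (X : history k -> R) : R :=
  \sum_(w : history k) prob R w * X w.

(* Main.v *)
From Stdlib Require Import NArith.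
Require Import Defs.
From mathcomp Require Import all_boot all_order all_algebra.
From mathcomp Require Import all_classical all_reals all_analysis.
From mathcomp Require Import ring lra zify.

Set Implicit Arguments.
Unset Strict Implicit.
Unset Printing Implicit Defensive.

Import Order.TTheory GRing.Theory Num.Theory.
Import numFieldNormedType.Exports.

Local Open Scope classical_set_scope.
Local Open Scope ring_scope.

(* The network is coded by a ternary tree: inner nodes are the inserted vertices,
   leaves the bounded faces.  Inside a triangle with centre v, for each two of
   its three corners there is a path between them that avoids the third corner
   and runs through any prescribed two of the three subtriangles, switching
   from one to the other at v.  Hence, if g(T) is the recursive gain
   "sum over the three subtrees minus the smallest term", the network has a path
   with at least g(T) + 2 vertices.

   (a) By concavity of x |-> x^a, a = log 2 / log 3, the two largest of three
   parts of m satisfy x^a + y^a >= m^a, so g >= m^a.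

   (b) The three subtree sizes follow a Polya urn, and conditionally on them the
   subtrees are independent random trees.  Put h(n) = prod_(j < n)
   (1 + 2 xi / (2 j + 1)), of order n^xi.  Then h(size of a fixed subtree) is a
   martingale up to a deterministic factor, so, after normalisation, the expected
   sum of h over the two largest subtrees, a maximum of martingales, is
   nondecreasing in time.  It thus suffices to compare it with h(N + 1) for a
   single N; for xi = 0.88 this holds at N = 80, by exact integer computation,
   and E[g] >= h / h(80) follows by induction on the size. *)

(** * Powers with exponent in the unit interval *)

(** Young's inequality for [y ^ a] and [1], with conjugate exponents [1 / a] and [1 / (1 - a)]; the
    right side is the tangent at [y = 1]. *)
Lemma powR_le_tangent (R : realType) (a y : R) :
  0 < a < 1 -> 0 <= y -> y `^ a <= a * y + (1 - a).
Proof.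
move=> /andP[a0 a1] y0.
have b0 : 0 < 1 - a by rewrite subr_gt0.
have := @conjugate_powR R (y `^ a) 1 a^-1 (1 - a)^-1 (powR_ge0 _ _) ler01.
rewrite !invr_gt0 !invrK powR1 mulr1 mul1r => /(_ a0 b0).
rewrite -powRrM divff ?gt_eqF// powRr1// [y * a]mulrC; apply.
by rewrite addrC subrK.
Qed.

(** After division by the weighted mean [m], the tangent at 1 bounds both powers, and the weighted
    sum of the two tangent values is exactly 1. *)
Lemma powR_concave (R : realType) (a s u v : R) :
  0 < a < 1 -> 0 <= s <= 1 -> 0 <= u -> 0 <= v -> 0 < s * u + (1 - s) * v ->
  s * u `^ a + (1 - s) * v `^ a <= (s * u + (1 - s) * v) `^ a.
Proof.
move=> a01 /andP[s0 s1] u0 v0; set m := (X in 0 < X) => m0.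
have scaled x : 0 <= x -> x `^ a = (x / m) `^ a * m `^ a.
  by move=> x0; rewrite -powRM ?divr_ge0 ?(ltW m0)// divfK ?gt_eqF.
rewrite (scaled _ u0) (scaled _ v0) !mulrA -mulrDl.
rewrite -[leRHS]mul1r ler_wpM2r ?powR_ge0//.
have /(ler_wpM2l s0) hu := powR_le_tangent a01 (divr_ge0 u0 (ltW m0)).
have s1' : 0 <= 1 - s by rewrite subr_ge0.
have /(ler_wpM2l s1') hv := powR_le_tangent a01 (divr_ge0 v0 (ltW m0)).
apply: (le_trans (lerD hu hv)); rewrite le_eqVlt; apply/orP; left; apply/eqP.
have -> : s * (a * (u / m) + (1 - a)) + (1 - s) * (a * (v / m) + (1 - a))
        = a * ((s * u + (1 - s) * v) / m) + (1 - a) by ring.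
by rewrite -/m divff ?gt_eqF// mulr1 addrC subrK.
Qed.

Lemma ln2_div_ln3_itv (R : realType) : 0 < (ln 2 / ln 3 : R) < 1.
Proof.
have l2 : 0 < ln 2 :> R by rewrite ln_gt0 ?ltr1n.
have l3 : 0 < ln 3 :> R by rewrite ln_gt0 ?ltr1n.
by rewrite divr_gt0//= ltr_pdivrMr// mul1r ltr_ln ?posrE// ltr_nat.
Qed.

(** The exponent is the one for which [3 ^ a = 2]. *)
Lemma powR_third (R : realType) (x : R) : 0 <= x ->
  (x / 3) `^ (ln 2 / ln 3) = x `^ (ln 2 / ln 3) / 2.
Proof.
move=> x0; rewrite powRM ?invr_ge0 ?ler0n//; congr (_ * _).
have l3 : 0 < ln 3 :> R by rewrite ln_gt0 ?ltr1n.
have e3 : 3 `^ (ln 2 / ln 3) = 2 :> R.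
  by rewrite /powR pnatr_eq0/= divfK ?gt_eqF// lnK ?posrE.
by rewrite -powR_inv1// powRAC e3 powR_inv1.
Qed.

(* After normalising to M = 1, the map t |-> t^a + (1 - 2t)^a is concave and
   equals 1 at both t = 0 and t = 1/3. *)
Lemma powR_two_largest (R : realType) (x y z : R) (a := ln 2 / ln 3) :
  0 < z -> z <= y -> y <= x -> (x + y + z) `^ a <= x `^ a + y `^ a.
Proof.
move=> z0 zy yx; set M := x + y + z.
have y0 : 0 < y by apply: lt_le_trans zy.
have M0 : 0 < M by rewrite /M; lra.
have a01 : 0 < a < 1 := ln2_div_ln3_itv R.
have a0 : 0 <= a by case/andP: a01 => /ltW.
have mono u v : 0 <= u -> u <= v -> u `^ a <= v `^ a.
  by move=> u0 uv; apply: ge0_ler_powR; rewrite ?nnegrE// (le_trans u0).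
(* If [y >= M / 3], then also [x >= M / 3], and each term is at least [M ^ a / 2]. *)
have [yM|My] := leP (M / 3) y.
  have hy := mono _ _ (divr_ge0 (ltW M0) (ler0n _ 3)) yM.
  have hx := mono _ _ (ltW y0) yx.
  move: hy; rewrite /a powR_third ?(ltW M0)// -/a => hy; lra.
(* Otherwise [y] lies between 0 and [M / 3], and [M - 2 * y <= x] is the matching combination of
   [M / 3] and [M]. The two concavity bounds add up to [(s / 2 + s / 2 + 1 - s) * M ^ a]. *)
pose s := 3 * y / M.
have s01 : 0 <= s <= 1.
  rewrite divr_ge0 ?mulr_ge0 ?(ltW y0) ?(ltW M0)//=.
  by rewrite ler_pdivrMr// mul1r; lra.
have M0' : M != 0 by rewrite gt_eqF.
have ey : s * (M / 3) + (1 - s) * 0 = y by rewrite /s; field.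
have ex : s * (M / 3) + (1 - s) * M = M - 2 * y by rewrite /s; field.
have c1 := @powR_concave R a s (M / 3) 0 a01 s01 (divr_ge0 (ltW M0) (ler0n _ 3)) (lexx _).
have c2 := @powR_concave R a s (M / 3) M a01 s01 (divr_ge0 (ltW M0) (ler0n _ 3)) (ltW M0).
rewrite ey in c1; rewrite ex in c2.
have {}c1 := c1 y0.
have Mx : 0 < M - 2 * y by lra.
have {}c2 := c2 Mx.
have hx : (M - 2 * y) `^ a <= x `^ a by apply: mono; rewrite /M; lra.
rewrite powR0 ?gt_eqF ?(andP a01).1// in c1.
rewrite /a !powR_third ?(ltW M0)// -/a in c1 c2.
lra.
Qed.

(** * Random trees and the urn of subtree sizes *)

Inductive tree := Leaf | Node of tree & tree & tree.

Fixpoint nodes (t : tree) : nat :=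
  if t is Node a b c then (nodes a + nodes b + nodes c).+1 else 0.

(** The value counts the interior vertices of a path between two corners, plus one: a leaf offers a
    bare edge, and joining two paths at the centre adds their values. *)
Fixpoint gain (t : tree) : nat :=
  if t is Node a b c then
    gain a + gain b + gain c - minn (gain a) (minn (gain b) (gain c))
  else 1.

Lemma gain_gt0 (t : tree) : (0 < gain t)%N.
Proof. by elim: t => //= a ha b hb c hc; lia. Qed.

Lemma gain_pairs (a b c : tree) :
  [/\ (gain a + gain b <= gain (Node a b c))%N,
      (gain a + gain c <= gain (Node a b c))%N
    & (gain b + gain c <= gain (Node a b c))%N].
Proof. by split=> /=; lia. Qed.

(* [grow f t] sums [f] over the trees obtained from [t] by turning one leaf
   into an inner node. *)
Fixpoint grow (V : nmodType) (f : tree -> V) (t : tree) : V :=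
  if t is Node a b c then
    grow (fun x => f (Node x b c)) a + grow (fun x => f (Node a x c)) b
    + grow (fun x => f (Node a b x)) c
  else f (Node Leaf Leaf Leaf).

Definition grow3 (V : nmodType) (F : tree -> tree -> tree -> V)
    (a b c : tree) : V :=
  grow (fun x => F x b c) a + grow (fun x => F a x c) b
  + grow (fun x => F a b x) c.

(* A subtree with i inner nodes has i.*2.+1 leaves. *)
Definition urn (R : pzSemiRingType) (c : nat -> nat -> nat -> R)
    (i j l : nat) : R :=
  i.*2.+1%:R * c i.+1 j l + j.*2.+1%:R * c i j.+1 l + l.*2.+1%:R * c i j l.+1.

Lemma growD (V : nmodType) (f g : tree -> V) (t : tree) :
  grow (fun x => f x + g x) t = grow f t + grow g t.
Proof.
elim: t f g => [//|a ha b hb c hc] f g /=.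
by rewrite ha hb hc [RHS]addrACA; congr (_ + _); exact: addrACA.
Qed.

Lemma growZ (R : pzSemiRingType) (k : R) (f : tree -> R) (t : tree) :
  grow (fun x => k * f x) t = k * grow f t.
Proof. by elim: t f => [//|a ha b hb c hc] f /=; rewrite ha hb hc !mulrDr. Qed.

Lemma grow_cst (R : pzSemiRingType) (k : R) (t : tree) :
  grow (fun=> k) t = (nodes t).*2.+1%:R * k.
Proof.
elim: t k => [|a ha b hb c hc] k /=; first by rewrite mul1r.
by rewrite ha hb hc -!mulrDl -!natrD; congr (_%:R * _); lia.
Qed.

(** Every tree in the sum has exactly one inner node more than [t]. *)
Lemma grow_nodes (V : nmodType) (F : nat -> tree -> V) (t : tree) :
  grow (fun x => F (nodes x) x) t = grow (F (nodes t).+1) t.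
Proof.
elim: t F => [//|a ha b hb c hc] F /=.
rewrite (ha (fun n x => F (n + nodes b + nodes c).+1 (Node x b c))).
rewrite (hb (fun n x => F (nodes a + n + nodes c).+1 (Node a x c))).
rewrite (hc (fun n x => F (nodes a + nodes b + n).+1 (Node a b x))).
by rewrite !addSn !addnS !addSn.
Qed.

Lemma ler_grow (R : numDomainType) (f g : tree -> R) (t : tree) :
  (forall x, f x <= g x) -> grow f t <= grow g t.
Proof.
elim: t f g => [|a ha b hb c hc] f g fg /=; first exact: fg.
by rewrite !lerD// (ha, hb, hc).
Qed.

Lemma ler_iter_grow3 (R : numDomainType) (F G : tree -> tree -> tree -> R)
    (k : nat) (a b c : tree) :
  (forall x y z, F x y z <= G x y z) ->
  iter k (@grow3 R) F a b c <= iter k (@grow3 R) G a b c.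
Proof.
move=> FG; elim: k a b c => [//|k IHk] a b c /=.
by rewrite /grow3 !lerD// ler_grow.
Qed.

Lemma iter_grow3D (V : nmodType) (F G : tree -> tree -> tree -> V) (k : nat) :
  iter k (@grow3 V) (fun x y z => F x y z + G x y z)
  = fun x y z => iter k (@grow3 V) F x y z + iter k (@grow3 V) G x y z.
Proof.
elim: k => [//|k IHk]; apply/funext => a; apply/funext => b; apply/funext => c.
by rewrite !iterS IHk /grow3 !growD [RHS]addrACA; congr (_ + _); exact: addrACA.
Qed.

Lemma iter_grow_Node (V : nmodType) (f : tree -> V) (k : nat) (a b c : tree) :
  iter k (@grow V) f (Node a b c)
  = iter k (@grow3 V) (fun x y z => f (Node x y z)) a b c.
Proof.
elim: k a b c => [//|k IHk] a b c; rewrite !iterS /= /grow3.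
by congr (grow _ _ + grow _ _ + grow _ _); apply/funext => x.
Qed.

(** * Averages over random trees *)

Definition odd_prod (R : pzSemiRingType) (n : nat) : R :=
  \prod_(j < n) j.*2.+1%:R.

Lemma odd_prodS (R : pzSemiRingType) (n : nat) :
  odd_prod R n.+1 = odd_prod R n * n.*2.+1%:R.
Proof. exact: big_ord_recr. Qed.

Lemma odd_prod_gt0 (R : numDomainType) (n : nat) : 0 < odd_prod R n.
Proof. by apply: prodr_gt0 => j _; rewrite ltr0n. Qed.

(** Iterated [grow] sums over all histories of [n] steps, of which there are [odd_prod n], all
    equally likely; the quotient is an expectation. *)
Definition mean (R : numFieldType) (f : tree -> R) (n : nat) : R :=
  iter n (@grow R) f Leaf / odd_prod R n.

Lemma mean_grow (R : numFieldType) (f : tree -> R) (n : nat) :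
  mean (grow f) n = n.*2.+1%:R * mean f n.+1.
Proof.
rewrite /mean -iterSr odd_prodS invfM.
by rewrite [_^-1 * _]mulrC !mulrA [_%:R * _]mulrC mulfK// pnatr_eq0.
Qed.

Lemma ler_mean (R : numFieldType) (f g : tree -> R) (n : nat) :
  (forall x, f x <= g x) -> mean f n <= mean g n.
Proof.
move=> fg; rewrite /mean ler_pM2r ?invr_gt0 ?odd_prod_gt0//.
by elim: n Leaf => [//|n IHn] t /=; apply: ler_grow.
Qed.

Lemma iter_urnD (R : comPzSemiRingType) (c d : nat -> nat -> nat -> R) (k : nat) :
  iter k (@urn R) (fun i j l => c i j l + d i j l)
  = fun i j l => iter k (@urn R) c i j l + iter k (@urn R) d i j l.
Proof.
elim: k => [//|k IHk]; apply/funext => i; apply/funext => j; apply/funext => l.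
by rewrite !iterS IHk /urn; ring.
Qed.

(* Given their sizes, the three subtrees below the root are independent and
   each of them is distributed as a random tree of its size. *)
Lemma iter_grow3_urn (R : numFieldType) (c : nat -> nat -> nat -> R)
    (f g h : tree -> R) (k : nat) :
  iter k (@grow3 R) (fun x y z => c (nodes x) (nodes y) (nodes z)
                                  * (f x * g y * h z)) Leaf Leaf Leaf
  = iter k (@urn R) (fun i j l => c i j l * (mean f i * mean g j * mean h l))
      0%N 0%N 0%N.
Proof.
elim: k c f g h => [|k IHk] c f g h.
  by rewrite /= /mean /odd_prod !big_ord0 !divr1.
rewrite !iterSr.
(* Growth in one subtree shifts its size argument in [c] and replaces its factor by [grow] of it, so
   the product form survives as a sum of three terms. *)
have -> : grow3 (fun x y z => c (nodes x) (nodes y) (nodes z) * (f x * g y * h z))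
  = fun x y z =>
      (c (nodes x).+1 (nodes y) (nodes z) * (grow f x * g y * h z)
      + c (nodes x) (nodes y).+1 (nodes z) * (f x * grow g y * h z))
      + c (nodes x) (nodes y) (nodes z).+1 * (f x * g y * grow h z).
  apply/funext => x; apply/funext => y; apply/funext => z; rewrite /grow3.
  rewrite (grow_nodes (fun n t => c n (nodes y) (nodes z) * (f t * g y * h z))).
  rewrite (grow_nodes (fun n t => c (nodes x) n (nodes z) * (f x * g t * h z))).
  rewrite (grow_nodes (fun n t => c (nodes x) (nodes y) n * (f x * g y * h t))).
  rewrite !growZ.
  have -> : (fun t => f t * g y * h z) = fun t => g y * h z * f t.
    by apply/funext => t; ring.
  have -> : (fun t => f x * g t * h z) = fun t => f x * h z * g t.
    by apply/funext => t; ring.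
  by rewrite !growZ; ring.
rewrite !iter_grow3D.
rewrite (IHk (fun i j l => c i.+1 j l)) (IHk (fun i j l => c i j.+1 l)).
rewrite (IHk (fun i j l => c i j l.+1)).
(* On the urn side, [mean_grow] absorbs the leaf counts, giving the same three terms. *)
have -> : urn (fun i j l => c i j l * (mean f i * mean g j * mean h l))
  = fun i j l =>
    (c i.+1 j l * (mean (grow f) i * mean g j * mean h l)
    + c i j.+1 l * (mean f i * mean (grow g) j * mean h l))
    + c i j l.+1 * (mean f i * mean g j * mean (grow h) l).
  apply/funext => i; apply/funext => j; apply/funext => l.
  by rewrite /urn !mean_grow; ring.
by rewrite !iter_urnD.
Qed.

Lemma mean_nodes (R : numFieldType) (c : nat -> R) (n : nat) :
  mean (fun t => c (nodes t)) n = c n.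
Proof.
elim: n c => [|n IHn] c; first by rewrite /mean /odd_prod big_ord0 divr1.
have n0 : n.*2.+1%:R != 0 :> R by rewrite pnatr_eq0.
apply: (mulfI n0); rewrite -mean_grow -(IHn (fun n => n.*2.+1%:R * c n.+1)).
congr mean; apply/funext => t.
by rewrite (grow_nodes (fun n _ => c n)) grow_cst.
Qed.

(* The smallest of the three subtrees is dropped. *)
Definition keep1 (i j l : nat) : bool := ~~ ((i <= j) && (i <= l))%N.
Definition keep2 (i j l : nat) : bool := ~~ (keep1 i j l && (j <= l)%N).
Definition keep3 (i j l : nat) : bool := ~~ (keep1 i j l && keep2 i j l).

Definition kept (R : pzSemiRingType) (x y z : nat -> R) (i j l : nat) : R :=
  (keep1 i j l)%:R * x i + (keep2 i j l)%:R * y j + (keep3 i j l)%:R * z l.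

Variant kept_spec (i j l : nat) : bool -> bool -> bool -> Prop :=
| Kept12 of (l <= i)%N & (l <= j)%N : kept_spec i j l true true false
| Kept13 of (j <= i)%N & (j <= l)%N : kept_spec i j l true false true
| Kept23 of (i <= j)%N & (i <= l)%N : kept_spec i j l false true true.

Lemma keptP (i j l : nat) :
  kept_spec i j l (keep1 i j l) (keep2 i j l) (keep3 i j l).
Proof.
rewrite /keep3 /keep2 /keep1.
case: (leqP i j) => ij; case: (leqP i l) => il; case: (leqP j l) => jl //=;
  constructor; lia.
Qed.

(** For nondecreasing [h], the smallest index carries the smallest value, so the kept pair is the
    best one. *)
Lemma kept_pairs (R : numDomainType) (h : nat -> R) (i j l : nat) :
  {homo h : m n / (m <= n)%N >-> m <= n} ->
  [/\ h i + h j <= kept h h h i j l, h i + h l <= kept h h h i j l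
    & h j + h l <= kept h h h i j l].
Proof.
move=> hm; rewrite /kept.
by case: keptP => h1 h2; split; rewrite !mul1r !mul0r ?addr0 ?add0r;
  rewrite ?lexx ?lerD2l ?lerD2r ?hm// [leLHS]addrC ?lerD2l ?lerD2r ?hm.
Qed.

(** The subtree of smallest size need not have the smallest gain, but the gain of the node dominates
    every pair. *)
Lemma kept_gain (R : numDomainType) (a b c : tree) (g := fun t => (gain t)%:R : R) :
  (keep1 (nodes a) (nodes b) (nodes c))%:R * g a
  + (keep2 (nodes a) (nodes b) (nodes c))%:R * g b
  + (keep3 (nodes a) (nodes b) (nodes c))%:R * g c <= g (Node a b c).
Proof.
have [gab gac gbc] := gain_pairs a b c.
by case: keptP => _ _; rewrite !mul1r mul0r ?addr0 ?add0r /g -natrD ler_nat.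
Qed.

(* Up to the deterministic factors, [growth x] evaluated at the size of a fixed
   subtree is a martingale. *)
Definition growth (R : numFieldType) (x : R) (n : nat) : R :=
  \prod_(j < n) (1 + x / j.*2.+1%:R).

Lemma growthS (R : numFieldType) (x : R) (n : nat) :
  n.*2.+1%:R * growth x n.+1 = (n.*2.+1%:R + x) * growth x n.
Proof.
rewrite /growth big_ord_recr /= mulrCA [RHS]mulrC mulrDr mulr1.
by rewrite [x / _]mulrC mulVKf// pnatr_eq0.
Qed.

Lemma growth_gt0 (R : numFieldType) (x : R) (n : nat) : 0 <= x -> 0 < growth x n.
Proof.
move=> x0; apply: prodr_gt0 => j _.
by rewrite ltr_pwDl// divr_ge0.
Qed.

Lemma growth_homo (R : numFieldType) (x : R) : 0 <= x ->
  {homo growth x : m n / (m <= n)%N >-> m <= n}.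
Proof.
move=> x0; apply: homo_leq => [//|? ? ?|n]; first exact: le_trans.
by rewrite /growth big_ord_recr /= ler_peMr ?(ltW (growth_gt0 _ x0))// lerDl divr_ge0.
Qed.

Lemma growth_odd_prod (R : numFieldType) (x : R) (n : nat) :
  growth x n * odd_prod R n = \prod_(j < n) (j.*2.+1%:R + x).
Proof.
rewrite /growth /odd_prod -big_split /=; apply: eq_bigr => j _.
by rewrite mulrDl mul1r divfK// pnatr_eq0.
Qed.

Lemma ler_urn (R : numDomainType) (c d : nat -> nat -> nat -> R) (n i j l : nat) :
  (forall i j l, (i + j + l)%N = n.+1 -> c i j l <= d i j l) ->
  (i + j + l)%N = n -> urn c i j l <= urn d i j l.
Proof.
by move=> cd eqn; rewrite /urn !lerD// ler_wpM2l// cd; lia.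
Qed.

Lemma ler_iter_urn (R : numDomainType) (c d : nat -> nat -> nat -> R)
    (k n i j l : nat) :
  (forall i j l, (i + j + l)%N = (n + k)%N -> c i j l <= d i j l) ->
  (i + j + l)%N = n -> iter k (@urn R) c i j l <= iter k (@urn R) d i j l.
Proof.
elim: k n i j l => [|k IHk] n i j l cd eqn; first by apply: cd; rewrite addn0.
rewrite !iterS; apply: ler_urn eqn => i' j' l' e; apply: IHk e => i2 j2 l2 e2.
by apply: cd; rewrite addnS -addSn.
Qed.

Lemma iter_urnZ (R : comPzSemiRingType) (a : R) (c : nat -> nat -> nat -> R) (k : nat) :
  iter k (@urn R) (fun i j l => a * c i j l)
  = fun i j l => a * iter k (@urn R) c i j l.
Proof.
elim: k => [//|k IHk]; apply/funext => i; apply/funext => j; apply/funext => l.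
by rewrite !iterS IHk /urn; ring.
Qed.

(* For each fixed pair equality holds, and [kept] is the maximum over pairs. *)
Lemma urn_kept (R : numFieldType) (x : R) (i j l : nat) (h := growth x) :
  0 <= x ->
  ((i + j + l).*2.+3%:R + x) * kept h h h i j l <= urn (kept h h h) i j l.
Proof.
rewrite {}/h => x0; have hm := growth_homo x0.
have [i1 i2 i3] := kept_pairs i.+1 j l hm.
have [j1 j2 j3] := kept_pairs i j.+1 l hm.
have [l1 l2 l3] := kept_pairs i j l.+1 hm.
have -> : (i + j + l).*2.+3%:R = i.*2.+1%:R + j.*2.+1%:R + l.*2.+1%:R :> R.
  by rewrite -!natrD; congr (_%:R); lia.
(* After the step, bound [kept] below by the pair kept before it; for that fixed pair [growthS]
   gives equality. *)
rewrite /urn {1}/kept; case: keptP => _ _; rewrite !mul1r mul0r ?addr0 ?add0r.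
- apply: le_trans (lerD (lerD (ler_wpM2l _ i1) (ler_wpM2l _ j1)) (ler_wpM2l _ l1)) => //.
  rewrite (mulrDr i.*2.+1%:R) (mulrDr j.*2.+1%:R) !growthS.
  by rewrite le_eqVlt; apply/orP; left; apply/eqP; ring.
- apply: le_trans (lerD (lerD (ler_wpM2l _ i2) (ler_wpM2l _ j2)) (ler_wpM2l _ l2)) => //.
  rewrite (mulrDr i.*2.+1%:R) (mulrDr l.*2.+1%:R) !growthS.
  by rewrite le_eqVlt; apply/orP; left; apply/eqP; ring.
- apply: le_trans (lerD (lerD (ler_wpM2l _ i3) (ler_wpM2l _ j3)) (ler_wpM2l _ l3)) => //.
  rewrite (mulrDr j.*2.+1%:R) (mulrDr l.*2.+1%:R) !growthS.
  by rewrite le_eqVlt; apply/orP; left; apply/eqP; ring.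
Qed.

(** By [urn_kept], each further step at total size [n] contributes at least [2n + 3 + x], which is
    exactly the next factor of the product. *)
Lemma iter_urn_kept (R : numFieldType) (x : R) (N k : nat) (h := growth x) :
  0 <= x ->
  \prod_(j < N.+1) (j.*2.+1%:R + x) <= iter N (@urn R) (kept h h h) 0%N 0%N 0%N ->
  (N <= k)%N ->
  \prod_(j < k.+1) (j.*2.+1%:R + x) <= iter k (@urn R) (kept h h h) 0%N 0%N 0%N.
Proof.
move=> x0 hN /subnK <-; elim: (k - N)%N => [//|m IHm]; rewrite addSn.
rewrite big_ord_recr iterSr /= mulrC.
apply: (@le_trans _ _ (iter (m + N) (@urn R)
    (fun i j l => ((m + N).*2.+3%:R + x) * kept h h h i j l) 0%N 0%N 0%N)).
  by rewrite iter_urnZ ler_wpM2l// addr_ge0.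
by apply: (@ler_iter_urn _ _ _ _ 0%N) => // i j l; rewrite add0n => <-; exact: urn_kept.
Qed.

(** Strong induction on [n]. Up to [N] the left side is at most 1 and gains are positive; beyond,
    the first step makes the root and the other [k] steps run the urn. *)
Lemma mean_gain_ge (R : numFieldType) (x : R) (N n : nat) (h := growth x)
    (g := fun t => (gain t)%:R : R) :
  0 <= x ->
  \prod_(j < N.+1) (j.*2.+1%:R + x) <= iter N (@urn R) (kept h h h) 0%N 0%N 0%N ->
  (h N)^-1 * h n <= mean g n.
Proof.
move=> x0 hN; elim/ltn_ind: n => n IHn.
have hN0 := growth_gt0 N x0.
have [nN|] := leqP n N.
  apply: (@le_trans _ _ 1).
    by rewrite mulrC ler_pdivrMr// mul1r growth_homo.
  rewrite -(mean_nodes (fun=> 1) n); apply: ler_mean => t.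
  by rewrite ler1n gain_gt0.
case: n IHn => [//|k] IHk; rewrite ltnS => Nk.
rewrite /mean ler_pdivlMr ?odd_prod_gt0// -mulrA growth_odd_prod.
rewrite iterS /= -/(iter _ _ _).
rewrite iter_grow_Node.
apply: (@le_trans _ _ ((h N)^-1 * iter k (@urn R) (kept h h h) 0%N 0%N 0%N)).
  by rewrite ler_wpM2l ?invr_ge0 ?(ltW hN0)//; exact: iter_urn_kept Nk.
pose m := mean g.
(* The urn sizes sum to [k < n], so the induction hypothesis applies to each subtree. *)
apply: (@le_trans _ _ (iter k (@urn R) (kept m m m) 0%N 0%N 0%N)).
  rewrite -[leLHS]/((fun i j l => (h N)^-1 * iter k (@urn R) (kept h h h) i j l) 0%N 0%N 0%N).
  rewrite -iter_urnZ; apply: (@ler_iter_urn _ _ _ _ 0%N) => // i j l e.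
  have hi : (h N)^-1 * h i <= m i by apply: IHk; lia.
  have hj : (h N)^-1 * h j <= m j by apply: IHk; lia.
  have hl : (h N)^-1 * h l <= m l by apply: IHk; lia.
  by rewrite /kept 2!mulrDr !(mulrCA (h N)^-1) !lerD// ler_wpM2l.
pose one (_ : tree) : R := 1.
have m1 : mean one = fun=> 1.
  by apply/funext => i; exact: (mean_nodes (fun=> 1)).
(* Each kept term is a product in which the other two factors are the constant 1, which lets
   [iter_grow3_urn] lift the urn back to trees. *)
apply: (@le_trans _ _ (iter k (@grow3 R) (fun x y z =>
    ((keep1 (nodes x) (nodes y) (nodes z))%:R * (g x * one y * one z)
    + (keep2 (nodes x) (nodes y) (nodes z))%:R * (one x * g y * one z))
    + (keep3 (nodes x) (nodes y) (nodes z))%:R * (one x * one y * g z)) Leaf Leaf Leaf)).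
  rewrite !iter_grow3D !(iter_grow3_urn (fun i j l => (keep1 i j l)%:R)).
  rewrite !(iter_grow3_urn (fun i j l => (keep2 i j l)%:R)).
  rewrite !(iter_grow3_urn (fun i j l => (keep3 i j l)%:R)) m1.
  have -> : kept m m m = fun i j l => ((keep1 i j l)%:R * (m i * 1 * 1)
      + (keep2 i j l)%:R * (1 * m j * 1)) + (keep3 i j l)%:R * (1 * 1 * m l).
    by apply/funext => i; apply/funext => j; apply/funext => l; rewrite /kept !mul1r !mulr1.
  by rewrite !iter_urnD.
apply: ler_iter_grow3 => a b c; rewrite /one !mulr1 !mul1r; exact: kept_gain.
Qed.

(** * The computation at a fixed size *)

(* Fixed-point arithmetic over binary integers, with scale [s] and all
   divisions rounded down. *)
Fixpoint fix_table (num den : nat -> N) (s : N) (k n : nat) : seq N :=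
  s :: if n is n'.+1 then
         fix_table num den (N.div (N.mul (num k) s) (den k)) k.+1 n'
       else [::].

Definition sum_fix (F : nat -> N) (n : nat) : N :=
  foldr (fun j r => N.add (F j) r) 0%num (iota 0 n.+1).

Definition prod_fix (a b n : nat) : N :=
  foldr (fun j r => N.mul (N.of_nat (a * j + b)) r) 1%num (iota 0 n).

Definition kept_fix (h : seq N) (i j l : nat) : N :=
  N.add (N.add (if keep1 i j l then nth 0%num h i else 0%num)
               (if keep2 i j l then nth 0%num h j else 0%num))
        (if keep3 i j l then nth 0%num h l else 0%num).

Definition urn_fix (w h : seq N) (n : nat) : N :=
  sum_fix (fun i => N.mul (nth 0%num w i) (sum_fix (fun j =>
    N.mul (nth 0%num w j) (N.mul (nth 0%num w (n - i - j)%N)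
      (kept_fix h i j (n - i - j)%N))) (n - i))) n.

Definition weight_table (s : N) (n : nat) : seq N :=
  fix_table (fun k => N.of_nat (2 * k + 1)) (fun k => N.of_nat (2 * k + 2)) s 0 n.

(** The ratio is [1 + x / (2k + 1)] for [x = 44 / 25], twice the exponent 0.88. *)
Definition growth_table (s : N) (n : nat) : seq N :=
  fix_table (fun k => N.of_nat (50 * k + 69)) (fun k => N.of_nat (50 * k + 25)) s 0 n.

(** The hypothesis of [mean_gain_ge] with denominators cleared: [s ^ 4] for three weights and one
    growth value, [25 ^ (n + 1)] for the denominator of [x]. *)
Definition kept_check (s : N) (n : nat) : bool :=
  N.leb (N.mul (N.pow s 4) (prod_fix 50 69 n.+1))
        (N.mul (prod_fix 0 25 n.+1) (N.mul (prod_fix 2 2 n)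
           (urn_fix (weight_table s n) (growth_table s n) n))).

(** * Convolution sums and the explicit law of the urn *)

Definition conv2 (R : pzSemiRingType) (n : nat) (F : nat -> nat -> R) : R :=
  \sum_(j < n.+1) F j (n - j)%N.

Definition conv3 (R : pzSemiRingType) (n : nat) (F : nat -> nat -> nat -> R) : R :=
  \sum_(i < n.+1) conv2 (n - i) (F i).

Lemma conv2_shiftl (R : pzSemiRingType) (n : nat) (F : nat -> nat -> R) :
  (forall l, F 0%N l = 0) -> conv2 n (fun j l => F j.+1 l) = conv2 n.+1 F.
Proof.
by move=> F0; rewrite /conv2 [RHS]big_ord_recl F0 add0r; apply: eq_bigr.
Qed.

Lemma conv2_shiftr (R : pzSemiRingType) (n : nat) (F : nat -> nat -> R) :
  (forall j, F j 0%N = 0) -> conv2 n (fun j l => F j l.+1) = conv2 n.+1 F.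
Proof.
move=> F0; rewrite /conv2 [RHS]big_ord_recr /= subnn F0 addr0.
by apply: eq_bigr => j _; rewrite subSn// -ltnS.
Qed.

Lemma conv3_shift1 (R : pzSemiRingType) (n : nat) (F : nat -> nat -> nat -> R) :
  (forall j l, F 0%N j l = 0) -> conv3 n (fun i => F i.+1) = conv3 n.+1 F.
Proof.
move=> F0; rewrite /conv3 [RHS]big_ord_recl [X in _ = X + _]big1 ?add0r//.
Qed.

Lemma conv3_shift2 (R : pzSemiRingType) (n : nat) (F : nat -> nat -> nat -> R) :
  (forall i l, F i 0%N l = 0) -> conv3 n (fun i j l => F i j.+1 l) = conv3 n.+1 F.
Proof.
move=> F0; rewrite /conv3 [RHS]big_ord_recr /= subnn.
rewrite [X in _ = _ + X]big_ord_recl big_ord0 F0 !addr0.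
by apply: eq_bigr => i _; rewrite conv2_shiftl// subSn// -ltnS.
Qed.

Lemma conv3_shift3 (R : pzSemiRingType) (n : nat) (F : nat -> nat -> nat -> R) :
  (forall i j, F i j 0%N = 0) -> conv3 n (fun i j l => F i j l.+1) = conv3 n.+1 F.
Proof.
move=> F0; rewrite /conv3 [RHS]big_ord_recr /= subnn.
rewrite [X in _ = _ + X]big_ord_recl big_ord0 F0 !addr0.
by apply: eq_bigr => i _; rewrite conv2_shiftr// subSn// -ltnS.
Qed.

Lemma eq_conv3 (R : pzSemiRingType) (n : nat) (F G : nat -> nat -> nat -> R) :
  (forall i j l, (i + j + l)%N = n -> F i j l = G i j l) -> conv3 n F = conv3 n G.
Proof.
move=> FG; apply: eq_bigr => i _; apply: eq_bigr => j _; apply: FG.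
by have := ltn_ord i; have := ltn_ord j; lia.
Qed.

Lemma conv3D (R : pzSemiRingType) (n : nat) (F G : nat -> nat -> nat -> R) :
  conv3 n (fun i j l => F i j l + G i j l) = conv3 n F + conv3 n G.
Proof. by rewrite -big_split; apply: eq_bigr => i _; rewrite -big_split. Qed.

Lemma conv3Z (R : pzSemiRingType) (n : nat) (a : R) (F : nat -> nat -> nat -> R) :
  conv3 n (fun i j l => a * F i j l) = a * conv3 n F.
Proof.
by rewrite /conv3 big_distrr; apply: eq_bigr => i _; rewrite /conv2 big_distrr.
Qed.

(** This is the central binomial coefficient divided by [4 ^ n]. *)
Definition weight (R : numFieldType) (n : nat) : R :=
  \prod_(j < n) (j.*2.+1%:R / j.*2.+2%:R).

Definition even_prod (R : pzSemiRingType) (n : nat) : R :=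
  \prod_(j < n) j.*2.+2%:R.

Lemma weightS (R : numFieldType) (n : nat) :
  weight R n.+1 * n.*2.+2%:R = weight R n * n.*2.+1%:R.
Proof. by rewrite /weight big_ord_recr /= -mulrA divfK// pnatr_eq0. Qed.

Lemma weight_ge0 (R : numFieldType) (n : nat) : 0 <= weight R n.
Proof. by apply: prodr_ge0 => j _; rewrite divr_ge0. Qed.

(* The three subtree sizes follow a Pólya urn, whose law is explicit. *)
Lemma iter_urn_conv3 (R : numFieldType) (c : nat -> nat -> nat -> R) (n : nat) :
  iter n (@urn R) c 0%N 0%N 0%N
  = even_prod R n
    * conv3 n (fun i j l => weight R i * weight R j * weight R l * c i j l).
Proof.
pose w := weight R; elim: n c => [|n IHn] c.
  by rewrite /even_prod /conv3 /conv2 !big_ord_recl !big_ord0 /weight !big_ord0 !(mul1r, addr0).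
have -> : even_prod R n.+1 = even_prod R n * n.*2.+2%:R by exact: big_ord_recr.
rewrite iterSr IHn -mulrA; congr (_ * _).
pose F i j l := w i * w j * w l * c i j l.
(* Split [2(n + 1)] as [2i + 2j + 2l]. Each part vanishes where its own index is 0, so that index
   can be shifted, and [weightS] produces the leaf counts. *)
transitivity (conv3 n.+1 (fun i j l => i.*2%:R * F i j l)
  + conv3 n.+1 (fun i j l => j.*2%:R * F i j l)
  + conv3 n.+1 (fun i j l => l.*2%:R * F i j l)); last first.
  rewrite -!conv3D -conv3Z; apply: eq_conv3 => i j l e.
  by rewrite -!mulrDl -!natrD; congr (_%:R * _); lia.
rewrite -(@conv3_shift1 R n (fun i j l => i.*2%:R * F i j l)); last by move=> *; rewrite mul0r.
rewrite -(@conv3_shift2 R n (fun i j l => j.*2%:R * F i j l)); last by move=> *; rewrite mul0r.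
rewrite -(@conv3_shift3 R n (fun i j l => l.*2%:R * F i j l)); last by move=> *; rewrite mul0r.
rewrite -!conv3D; apply: eq_conv3 => i j l _.
have wS m : m.+1.*2%:R * w m.+1 = m.*2.+1%:R * w m.
  by rewrite mulrC doubleS weightS mulrC.
have -> : i.+1.*2%:R * F i.+1 j l = i.+1.*2%:R * w i.+1 * (w j * w l * c i.+1 j l).
  by rewrite /F; ring.
have -> : j.+1.*2%:R * F i j.+1 l = j.+1.*2%:R * w j.+1 * (w i * w l * c i j.+1 l).
  by rewrite /F; ring.
have -> : l.+1.*2%:R * F i j l.+1 = l.+1.*2%:R * w l.+1 * (w i * w j * c i j l.+1).
  by rewrite /F; ring.
by rewrite !wS /urn -/w; ring.
Qed.

(** * Soundness of the integer computation *)

Definition NtoR (R : pzSemiRingType) (n : N) : R := (N.to_nat n)%:R.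

Lemma NtoR_add (R : pzSemiRingType) (m n : N) :
  NtoR R (N.add m n) = NtoR R m + NtoR R n.
Proof. by rewrite /NtoR N2Nat.inj_add natrD. Qed.

Lemma NtoR_mul (R : pzSemiRingType) (m n : N) :
  NtoR R (N.mul m n) = NtoR R m * NtoR R n.
Proof. by rewrite /NtoR N2Nat.inj_mul natrM. Qed.

Lemma NtoR_of_nat (R : pzSemiRingType) (n : nat) : NtoR R (N.of_nat n) = n%:R.
Proof. by rewrite /NtoR Nat2N.id. Qed.

Lemma NtoR_ge0 (R : numDomainType) (n : N) : 0 <= NtoR R n.
Proof. exact: ler0n. Qed.

Lemma NtoR_le (R : numDomainType) (m n : N) : N.leb m n -> NtoR R m <= NtoR R n.
Proof. by move=> /N.leb_le h; rewrite /NtoR ler_nat; lia. Qed.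

Lemma NtoR_div (R : numDomainType) (m n : N) :
  NtoR R n * NtoR R (N.div m n) <= NtoR R m.
Proof.
rewrite -NtoR_mul; apply: NtoR_le; apply/N.leb_le.
by case: n => [|p]; [lia | exact: N.Div0.mul_div_le].
Qed.

(** Rounding down only lowers entries, and past the end of the table the default 0 is still a lower
    bound. *)
Lemma fix_table_le (R : numFieldType) (num den : nat -> N) (a : R)
    (f : nat -> R) (s : N) (k n i : nat) :
  (forall j, 0 <= a * f j) -> (forall j, 0 < NtoR R (den j)) ->
  (forall j, f j.+1 * NtoR R (den j) = f j * NtoR R (num j)) ->
  NtoR R s <= a * f k ->
  NtoR R (nth 0%num (fix_table num den s k n) i) <= a * f (k + i)%N.
Proof.
move=> f0 den0 fS; elim: n s k i => [|n IHn] s k [|i] sk /=; rewrite ?addn0//.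
  by rewrite nth_nil /NtoR.
rewrite addnS -addSn; apply: IHn.
rewrite -(ler_pM2l (den0 k)); apply: le_trans (NtoR_div _ _ _) _.
have -> : NtoR R (den k) * (a * f k.+1) = NtoR R (num k) * (a * f k).
  by rewrite mulrCA [NtoR R (den k) * _]mulrC fS; ring.
by rewrite NtoR_mul ler_wpM2l// NtoR_ge0.
Qed.

Lemma NtoR_sum (R : pzSemiRingType) (F : nat -> N) (n : nat) :
  NtoR R (sum_fix F n) = \sum_(j < n.+1) NtoR R (F j).
Proof.
rewrite /sum_fix -(big_mkord xpredT (fun j => NtoR R (F j))) /index_iota subn0.
elim: (iota _ _) => [|j s IHs] /=; first by rewrite big_nil.
by rewrite NtoR_add IHs big_cons.
Qed.

Lemma NtoR_prod (R : comPzSemiRingType) (a b n : nat) :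
  NtoR R (prod_fix a b n) = \prod_(j < n) (a * j + b)%:R.
Proof.
rewrite /prod_fix -(big_mkord xpredT (fun j => (a * j + b)%:R)) /index_iota subn0.
elim: (iota _ _) => [|j s IHs]; rewrite ?big_nil//=.
by rewrite NtoR_mul IHs big_cons NtoR_of_nat.
Qed.

Lemma urn_fix_le (R : numFieldType) (a : R) (f g : nat -> R) (w h : seq N) (n : nat) :
  (forall i, NtoR R (nth 0%num w i) <= a * f i) ->
  (forall i, NtoR R (nth 0%num h i) <= a * g i) ->
  NtoR R (urn_fix w h n)
  <= a ^+ 4 * conv3 n (fun i j l => f i * f j * f l * kept g g g i j l).
Proof.
move=> wf hg; rewrite NtoR_sum -conv3Z /conv3 /conv2; apply: ler_sum => i _.
rewrite NtoR_mul NtoR_sum big_distrr /=; apply: ler_sum => j _.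
rewrite !NtoR_mul; set l := (n - i - j)%N.
have hk : NtoR R (kept_fix h i j l) <= a * kept g g g i j l.
  rewrite /kept_fix /kept !NtoR_add 2!mulrDr !lerD//.
  - by case: keep1; rewrite ?mul1r// mul0r mulr0.
  - by case: keep2; rewrite ?mul1r// mul0r mulr0.
  - by case: keep3; rewrite ?mul1r// mul0r mulr0.
have -> : a ^+ 4 * (f i * f j * f l * kept g g g i j l)
  = (a * f i) * ((a * f j) * ((a * f l) * (a * kept g g g i j l))) by ring.
by rewrite !ler_pM// ?mulr_ge0// NtoR_ge0.
Qed.

Lemma kept_check_sound (R : numFieldType) (s : N) (n : nat)
    (h := growth (44 / 25 : R)) :
  (0 < s)%num -> kept_check s n ->
  \prod_(j < n.+1) (j.*2.+1%:R + 44 / 25)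
    <= iter n (@urn R) (kept h h h) 0%N 0%N 0%N.
Proof.
move=> s0 /(@NtoR_le R); rewrite (NtoR_mul _ (N.pow s 4)).
rewrite (NtoR_mul _ (prod_fix 0 25 _)) (NtoR_mul _ (prod_fix 2 2 _)).
have sR : 0 < NtoR R s by rewrite /NtoR ltr0n; lia.
have -> : NtoR R (N.pow s 4) = NtoR R s ^+ 4.
  rewrite -[4%num]/(N.succ (N.succ (N.succ (N.succ 0)))) !N.pow_succ_r'.
  by rewrite N.pow_0_r N.mul_1_r !NtoR_mul; ring.
have x0 : 0 <= 44 / 25 :> R by rewrite divr_ge0.
have -> : NtoR R (prod_fix 50 69 n.+1)
    = NtoR R (prod_fix 0 25 n.+1) * \prod_(j < n.+1) (j.*2.+1%:R + 44 / 25).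
  rewrite !NtoR_prod -big_split; apply: eq_bigr => j _ /=.
  by rewrite mulrDr mulrCA divff ?pnatr_eq0// mulr1 -natrM -natrD; congr (_%:R); lia.
rewrite mulrCA ler_pM2l; last first.
  by rewrite NtoR_prod; apply: prodr_gt0 => j _; rewrite ltr0n addn_gt0 orbT.
have -> : NtoR R (prod_fix 2 2 n) = even_prod R n.
  by rewrite NtoR_prod; apply: eq_bigr => j _; congr (_%:R); lia.
move=> le1; rewrite iter_urn_conv3 -(ler_pM2l (exprn_gt0 4 sR)).
apply: le_trans le1 _; rewrite mulrCA ler_wpM2l//.
  by apply: prodr_ge0 => j _; exact: ler0n.
apply: urn_fix_le => i; rewrite -[i in leRHS]add0n; apply: fix_table_le => [j|j|j|].
- by rewrite mulr_ge0 ?(ltW sR) ?weight_ge0.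
- by rewrite NtoR_of_nat ltr0n; lia.
- rewrite !NtoR_of_nat.
  have -> : (2 * j + 2 = j.*2.+2)%N by lia.
  have -> : (2 * j + 1 = j.*2.+1)%N by lia.
  exact: weightS.
- by rewrite /weight big_ord0 mulr1.
- by rewrite mulr_ge0 ?(ltW sR) ?(ltW (growth_gt0 _ x0)).
- by rewrite NtoR_of_nat ltr0n; lia.
- have := growthS (44 / 25 : R) j; rewrite !NtoR_of_nat => e.
  have -> : (50 * j + 25)%:R = 25 * j.*2.+1%:R :> R by rewrite -natrM; congr (_%:R); lia.
  have -> : (50 * j + 69)%:R = 25 * (j.*2.+1%:R + 44 / 25) :> R.
    by rewrite mulrDr mulrCA divff ?pnatr_eq0// mulr1 -natrM -natrD; congr (_%:R); lia.
  by rewrite mulrCA [_ * j.*2.+1%:R]mulrC e; rewrite /h; ring.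
- by rewrite /h /growth big_ord0 mulr1.
Qed.

(** At scale [10 ^ 6] the rounding losses are small enough for the inequality to survive. *)
Lemma kept_check80 : kept_check 1000000 80.
Proof. by vm_compute. Qed.

(** * Paths in the network *)

(* A leaf carries the index of its face in [faces], an inner node the vertex
   placed inside its triangle. *)
Inductive ltree := LLeaf of nat | LNode of nat & ltree & ltree & ltree.

Fixpoint shape (t : ltree) : tree :=
  if t is LNode _ a b c then Node (shape a) (shape b) (shape c) else Leaf.

Fixpoint leaves (t : ltree) : seq nat :=
  match t with
  | LLeaf i => [:: i]
  | LNode _ a b c => leaves a ++ leaves b ++ leaves c
  end.

Fixpoint inner (t : ltree) : seq nat :=
  if t is LNode v a b c then v :: inner a ++ inner b ++ inner c else [::].

(** With [n] the number of faces, the labels [i], [n], [n.+1] are the positions at which [subdivide]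
    stores the three new faces. *)
Fixpoint expand (i n v : nat) (t : ltree) : ltree :=
  match t with
  | LLeaf k => if k == i then LNode v (LLeaf i) (LLeaf n) (LLeaf n.+1) else t
  | LNode u a b c =>
      LNode u (expand i n v a) (expand i n v b) (expand i n v c)
  end.

Fixpoint history_tree (k : nat) : history k -> ltree :=
  match k with
  | 0 => fun=> LLeaf 0
  | k'.+1 => fun w : history k' * 'I_(k'.*2.+1) =>
      expand w.2 k'.*2.+1 k'.+3 (history_tree w.1)
  end.

Lemma count_leaves_expand (P : pred nat) (i n v : nat) (t : ltree) :
  count P (leaves (expand i n v t))
  = (count P (leaves t) + count_mem i (leaves t) * (P n + P n.+1))%N.
Proof.
elim: t => /= [k|u a ha b hb c hc]; last first.
  by rewrite !count_cat ha hb hc !mulnDl; lia.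
by have [->|ne] := eqVneq k i; rewrite /= ?eqxx ?(negbTE ne) !addn0 ?mul0n ?mul1n ?addn0// addnC.
Qed.

Lemma count_inner_expand (P : pred nat) (i n v : nat) (t : ltree) :
  count P (inner (expand i n v t))
  = (count P (inner t) + count_mem i (leaves t) * P v)%N.
Proof.
elim: t => /= [k|u a ha b hb c hc]; last first.
  by rewrite !count_cat ha hb hc !mulnDl; lia.
by case: eqVneq => _; rewrite /= !addn0 ?mul0n ?mul1n.
Qed.

Lemma expand_notin (i n v : nat) (t : ltree) :
  i \notin leaves t -> expand i n v t = t.
Proof.
elim: t => [k|u a ha b hb c hc] /=; first by rewrite mem_seq1 => /negbTE ik; rewrite eq_sym ik.
by rewrite !mem_cat !negb_or => /and3P[/ha-> /hb-> /hc->].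
Qed.

Lemma perm_leaves_history (k : nat) (w : history k) :
  perm_eq (leaves (history_tree w)) (iota 0 k.*2.+1).
Proof.
elim: k w => [//|k IHk] [w i]; apply/permP => P.
have -> : k.+1.*2.+1 = (k.*2.+1 + 2)%N by lia.
rewrite iotaD count_cat count_leaves_expand !(permP (IHk w)).
rewrite [count_mem _ _]count_uniq_mem ?iota_uniq// mem_iota leq0n add0n ltn_ord mul1n.
by rewrite [count P [:: _; _]]/= addn0.
Qed.

Lemma count_leaf_history (k : nat) (w : history k) (i : 'I_(k.*2.+1)) :
  count_mem (i : nat) (leaves (history_tree w)) = 1%N.
Proof.
rewrite (permP (perm_leaves_history w)) count_uniq_mem ?iota_uniq//.
by rewrite mem_iota leq0n add0n ltn_ord.
Qed.

Lemma perm_inner_history (k : nat) (w : history k) :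
  perm_eq (inner (history_tree w)) (iota 3 k).
Proof.
elim: k w => [//|k IHk] [w i]; apply/permP => P.
rewrite count_inner_expand (permP (IHk w)) count_leaf_history mul1n.
have -> : iota 3 k.+1 = iota 3 k ++ [:: k.+3] by rewrite -[in LHS](addn1 k) iotaD.
by rewrite count_cat /= addn0.
Qed.

(** Labels are distinct, so expanding a leaf of one subtree leaves the others intact; a uniform face
    choice thus becomes [grow]. *)
Lemma sum_expand (V : nmodType) (f : tree -> V) (n v : nat) (t : ltree) :
  uniq (leaves t) ->
  \sum_(i <- leaves t) f (shape (expand i n v t)) = grow f (shape t).
Proof.
elim: t f => [k|u a ha b hb c hc] f /=; first by rewrite big_seq1 eqxx.
rewrite !cat_uniq has_cat negb_or => /and3P[ua /andP[/hasPn ab /hasPn ac]].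
move=> /and3P[ub /hasPn bc uc].
rewrite !big_cat /= addrA -(ha (fun x => f (Node x _ _)))//.
rewrite -(hb (fun x => f (Node _ x _)))// -(hc (fun x => f (Node _ _ x)))//.
congr (_ + _ + _); apply: eq_big_seq => i it.
- rewrite (@expand_notin i _ _ b) ?(@expand_notin i _ _ c)//.
  + by apply: contraL it => /ac.
  + by apply: contraL it => /ab.
- by rewrite (expand_notin _ _ (ab _ it)) (@expand_notin i _ _ c)//; apply: contraL it => /bc.
- by rewrite (expand_notin _ _ (ac _ it)) (expand_notin _ _ (bc _ it)).
Qed.

(** * Embedding the tree in the network and joining paths *)

Definition eadj (E : seq (nat * nat)) : rel nat :=
  fun u v => ((u, v) \in E) || ((v, u) \in E).

Fixpoint embedded (E : seq (nat * nat)) (F : seq (nat * nat * nat)) (t : ltree)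
    (a b c : nat) : Prop :=
  match t with
  | LLeaf i => nth (0, 0, 0)%N F i = (a, b, c)
               /\ [/\ eadj E a b, eadj E b c & eadj E c a]
  | LNode v t1 t2 t3 => [/\ embedded E F t1 a b v, embedded E F t2 b c v
                          & embedded E F t3 c a v]
  end.

Lemma embedded_expand (G : plane_net) (i : nat) (t : ltree) (a b c : nat) :
  (i < size (faces G))%N -> (forall j, j \in leaves t -> (j < size (faces G))%N) ->
  embedded (edges G) (faces G) t a b c ->
  embedded (edges (subdivide G i)) (faces (subdivide G i))
    (expand i (size (faces G)) (nvert G) t) a b c.
Proof.
rewrite /subdivide; case def_f: (nth _ _ i) => [[x y] z] /= ilt.
set E := [:: _, _, _ & edges G]; set F := _ ++ _; set v := nvert G.
have sz : size (set_nth (0, 0, 0)%N (faces G) i (x, y, v)) = size (faces G).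
  by rewrite size_set_nth (maxn_idPr ilt).
have sub u u' : eadj (edges G) u u' -> eadj E u u'.
  by rewrite /eadj !inE => /orP[->|->]; rewrite !orbT.
elim: t a b c => [k|u t1 h1 t2 h2 t3 h3] a b c lt_leaf /=; last first.
  move=> [e1 e2 e3]; split; [apply: h1|apply: h2|apply: h3] => // j hj;
  by apply: lt_leaf; rewrite /= !mem_cat hj ?orbT.
have klt : (k < size (faces G))%N by apply: lt_leaf; rewrite inE.
move=> [nk [ab bc ca]]; case: eqP => [ki|/eqP ki] /=; last first.
  split; last by split; apply: sub.
  by rewrite /F nth_cat sz klt nth_set_nth /= (negbTE ki).
move: nk; rewrite ki def_f => -[? ? ?]; subst x y z.
have av : eadj E a v by rewrite /eadj !inE eqxx.
have bv : eadj E b v by rewrite /eadj !inE eqxx !orbT.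
have cv : eadj E c v by rewrite /eadj !inE eqxx !orbT.
have vsym u : eadj E v u = eadj E u v by rewrite /eadj orbC.
split; split; rewrite ?vsym//; try by split; rewrite ?vsym//; apply: sub.
- by rewrite /F nth_cat sz ilt nth_set_nth /= eqxx.
- by rewrite /F nth_cat sz ltnn subnn.
- by rewrite /F nth_cat sz ltnNge leqnSn /= subSnn.
Qed.

(** Here [q] is the interior of the path; [n] exceeds its size by one, so that lengths add when
    paths are joined at a vertex. *)
Definition linked (E : seq (nat * nat)) (s : seq nat) (x y n : nat) : Prop :=
  exists q, [/\ path (eadj E) x (rcons q y), uniq q, {subset q <= s}
              & (size q).+1 = n].

Lemma linked_sym (E : seq (nat * nat)) (s : seq nat) (x y n : nat) :
  linked E s x y n -> linked E s y x n.
Proof.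
move=> [q [pq uq qs sq]]; exists (rev q); split; rewrite ?rev_uniq ?size_rev//.
  have := rev_path (eadj E) x (rcons q y).
  rewrite last_rcons belast_rcons rev_cons => ->.
  by rewrite (eq_path (e' := eadj E))// => u v; rewrite /eadj orbC.
by move=> z; rewrite mem_rev => /qs.
Qed.

Lemma linked_join (E : seq (nat * nat)) (s1 s2 s : seq nat) (x v y m n : nat) :
  linked E s1 x v m -> linked E s2 v y n -> uniq (v :: s1 ++ s2) ->
  {subset v :: s1 ++ s2 <= s} -> linked E s x y (m + n).
Proof.
move=> [q1 [p1 u1 qs1 sz1]] [q2 [p2 u2 qs2 sz2]].
rewrite /= mem_cat negb_or cat_uniq => /andP[/andP[v1 v2] /and3P[_ /hasPn d _]] sub.
exists (rcons q1 v ++ q2); split.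
- by rewrite rcons_cat cat_path p1 last_rcons.
- rewrite cat_uniq rcons_uniq u1 u2 (contra (qs1 v) v1) !andbT andTb.
  apply/hasPn => z zq2; rewrite /= mem_rcons inE negb_or.
  apply/andP; split; first by apply: contraNneq v2 => <-; exact: qs2.
  by apply: contra (d _ (qs2 _ zq2)) => /qs1.
- move=> z; rewrite mem_cat mem_rcons inE => hz; apply: sub; rewrite inE mem_cat.
  by case/orP: hz => [/orP[->//|/qs1->]|/qs2->]; rewrite !orbT.
- by rewrite size_cat size_rcons; lia.
Qed.

(** Turns disjointness of vertex sets into linear arithmetic on multiplicities. *)
Lemma uniq_count (T : eqType) (s : seq T) :
  uniq s <-> forall x, (count_mem x s <= 1)%N.
Proof.
split=> [us x|]; first by rewrite count_uniq_mem ?leq_b1.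
elim: s => [//|x s IHs] h /=; apply/andP; split.
  by have := h x; rewrite /= eqxx add1n ltnS leqn0 => /eqP/count_memPn.
by apply: IHs => y; apply: leq_trans (h y); rewrite /= leq_addl.
Qed.

Lemma embedded_linked (E : seq (nat * nat)) (F : seq (nat * nat * nat))
    (t : ltree) (a b c : nat) :
  embedded E F t a b c -> uniq [:: a, b, c & inner t] ->
  [/\ linked E (inner t) a b (gain (shape t)),
      linked E (inner t) b c (gain (shape t))
    & linked E (inner t) c a (gain (shape t))].
Proof.
elim: t a b c => [k|v t1 h1 t2 h2 t3 h3] a b c.
  by move=> [_ [ab bc ca]] _; split; exists [::]; rewrite /= andbT.
move=> [e1 e2 e3] /uniq_count un.
have [|l1ab l1bv l1va] := h1 _ _ _ e1.
  by apply/uniq_count => x; have := un x; rewrite /= !count_cat; lia.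
have [|l2bc l2cv l2vb] := h2 _ _ _ e2.
  by apply/uniq_count => x; have := un x; rewrite /= !count_cat; lia.
have [|l3ca l3av l3vc] := h3 _ _ _ e3.
  by apply/uniq_count => x; have := un x; rewrite /= !count_cat; lia.
pose s := inner (LNode v t1 t2 t3).
have join (u u' : ltree) x y : linked E (inner u) x v (gain (shape u)) ->
    linked E (inner u') v y (gain (shape u')) ->
    (forall z, count_mem z (inner u) + count_mem z (inner u')
       <= count_mem z (inner t1) + count_mem z (inner t2) + count_mem z (inner t3))%N ->
    linked E s x y (gain (shape u) + gain (shape u')).
  move=> l l' le_cnt; apply: linked_join l l' _ _.
    apply/uniq_count => z; have := un z; have := le_cnt z.
    by rewrite /= !count_cat; lia.
  move=> z; rewrite -!has_pred1 !has_count; have := le_cnt z.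
  by rewrite /= !count_cat; lia.
have l12 x y : linked E (inner t1) x v (gain (shape t1)) ->
    linked E (inner t2) v y (gain (shape t2)) ->
    linked E s x y (gain (shape t1) + gain (shape t2)).
  by move=> l l'; apply: join => // z; lia.
have l13 x y : linked E (inner t1) x v (gain (shape t1)) ->
    linked E (inner t3) v y (gain (shape t3)) ->
    linked E s x y (gain (shape t1) + gain (shape t3)).
  by move=> l l'; apply: join => // z; lia.
have l23 x y : linked E (inner t2) x v (gain (shape t2)) ->
    linked E (inner t3) v y (gain (shape t3)) ->
    linked E s x y (gain (shape t2) + gain (shape t3)).
  by move=> l l'; apply: join => // z; lia.
(* Subtracting the smallest term leaves the sum over some pair of subtrees. *)
have : [\/ gain (Node (shape t1) (shape t2) (shape t3)) = gain (shape t1) + gain (shape t2),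
     gain (Node (shape t1) (shape t2) (shape t3)) = gain (shape t1) + gain (shape t3)
   | gain (Node (shape t1) (shape t2) (shape t3)) = gain (shape t2) + gain (shape t3)]%N.
  rewrite /=; set g1 := gain (shape t1); set g2 := gain (shape t2); set g3 := gain (shape t3).
  have [h|h] := leqP (g1 + g2) (maxn (g1 + g3) (g2 + g3)).
    have [h'|h'] := leqP (g1 + g3) (g2 + g3); first by apply: Or33; lia.
    by apply: Or32; lia.
  by apply: Or31; lia.
(* For any two subtriangles and any two corners, the corners can be assigned one to each
   subtriangle; the path goes through the centre [v], reversed where needed. *)
rewrite [shape _]/= => -[->|->|->]; split.
- exact: l12 (linked_sym l1va) l2vb.
- exact: l12 l1bv (linked_sym l2cv).
- exact: linked_sym (l12 _ _ (linked_sym l1va) (linked_sym l2cv)).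
- exact: linked_sym (l13 _ _ l1bv (linked_sym l3av)).
- exact: l13 l1bv l3vc.
- exact: linked_sym (l13 _ _ (linked_sym l1va) l3vc).
- exact: linked_sym (l23 _ _ (linked_sym l2vb) (linked_sym l3av)).
- exact: l23 (linked_sym l2vb) l3vc.
- exact: l23 l2cv (linked_sym l3av).
Qed.

Lemma leq_longest_path (T : finType) (e : rel T) (p : seq T) :
  uniq p -> sorted e p -> (size p <= longest_path e)%N.
Proof.
move=> up ep; have lt_p : (size p < #|T|.+1)%N.
  by rewrite ltnS -(card_uniqP up) max_card.
apply: (@leq_bigmax_cond _ _ (fun l : 'I_#|T|.+1 => l : nat) (Ordinal lt_p)).
by apply/existsP; exists (in_tuple p); rewrite /= up.
Qed.

Lemma map_val_ord (n : nat) (s : seq nat) :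
  (forall x, x \in s -> (x < n)%N) -> exists p : seq 'I_n, s = map val p.
Proof.
elim: s => [|x s IHs] h; first by exists [::].
have [|p ->] := IHs; first by move=> y ys; apply: h; rewrite inE ys orbT.
have xn : (x < n)%N by apply: h; rewrite mem_head.
by exists (Ordinal xn :: p).
Qed.

Lemma embedded_history (k : nat) (w : history k) :
  embedded (edges (ran w)) (faces (ran w)) (history_tree w) 0 1 2.
Proof.
elim: k w => [|k IHk] w; first by [].
have sz : size (faces (ran w.1)) = k.*2.+1 := size_faces_ran _.
have := @embedded_expand (ran w.1) w.2 (history_tree w.1) 0 1 2.
rewrite sz nvert_ran; apply => // j.
by rewrite (perm_mem (perm_leaves_history _)) mem_iota.
Qed.

Lemma outer_edge_history (k : nat) (w : history k) :
  (2, 0)%N \in edges (ran w).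
Proof.
elim: k w => [//|k IHk] [w i] /=; rewrite /subdivide.
by case: nth => [[a b] c]; rewrite !inE IHk !orbT.
Qed.

Lemma L_ge_gain (k : nat) (w : history k) :
  (gain (shape (history_tree w)) + 2 <= L w)%N.
Proof.
set t := history_tree w; have emb := embedded_history w.
have it x : x \in inner t -> (2 < x < k.+3)%N.
  by rewrite (perm_mem (perm_inner_history w)) mem_iota.
have ut : uniq [:: 0, 1, 2 & inner t]%N.
  rewrite (perm_uniq (s2 := iota 0 k.+3)) ?iota_uniq//.
  have -> : iota 0 k.+3 = [:: 0, 1, 2 & iota 3 k]%N by [].
  by rewrite !perm_cons perm_inner_history.
have [[q [pq uq qs sq]] _ _] := embedded_linked emb ut.
have e20 : eadj (edges (ran w)) 2 0 by rewrite /eadj outer_edge_history.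
(* The path from 0 to 1 avoids corner 2, which is prepended along the outer edge; three corners plus
   the size of [q] make the gain plus 2. *)
pose p := [:: 2, 0 & rcons q 1]%N.
have p_lt x : x \in p -> (x < nvert (ran w))%N.
  rewrite nvert_ran !inE mem_rcons inE => /or4P[/eqP->|/eqP->|/eqP->|]//.
  by move=> /qs/it/andP[].
have up : uniq p.
  rewrite /= !inE !mem_rcons !inE rcons_uniq uq andbT /=.
  have notq x : (x <= 2)%N -> x \notin q.
    by move=> x2; apply/negP => /qs/it/andP[]; rewrite ltnNge x2.
  by rewrite !notq.
have [p' ep] := map_val_ord p_lt.
have -> : (gain (shape t) + 2 = size p')%N.
  by rewrite -(size_map val) -ep /= size_rcons -sq addn2.
apply: leq_longest_path; first by rewrite -(map_inj_uniq val_inj) -ep.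
have : sorted (eadj (edges (ran w))) (map val p') by rewrite -ep /= e20.
by rewrite sorted_map.
Qed.

(** * The deterministic bound and the bound in expectation *)

Lemma powR_drop_smallest (R : realType) (x y z : R) (a := ln 2 / ln 3) :
  0 < z -> z <= x -> z <= y -> (x + y + z) `^ a <= x `^ a + y `^ a.
Proof.
move=> z0 zx zy; have [yx|/ltW xy] := leP y x; first exact: powR_two_largest.
by rewrite (addrC x) [leRHS]addrC; exact: powR_two_largest.
Qed.

(** The leaf counts of the subtrees add up at a node, and the two largest already carry the power of
    the total. *)
Lemma powR_le_gain (R : realType) (t : tree) :
  (nodes t).*2.+1%:R `^ (ln 2 / ln 3) <= (gain t)%:R :> R.
Proof.
elim: t => [|a ha b hb c hc]; first by rewrite powR1.
have -> : (nodes (Node a b c)).*2.+1%:R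
    = (nodes a).*2.+1%:R + (nodes b).*2.+1%:R + (nodes c).*2.+1%:R :> R.
  by rewrite -!natrD; congr (_%:R) => /=; lia.
have le_node m n : (m <= n)%N -> m.*2.+1%:R <= n.*2.+1%:R :> R.
  by move=> mn; rewrite ler_nat; lia.
have := @gain_pairs a b c; rewrite -!(ler_nat R) !natrD => -[gab gac gbc].
case: (keptP (nodes a) (nodes b) (nodes c)) => /le_node h1 /le_node h2.
- by apply: le_trans gab; apply: le_trans (lerD ha hb); apply: powR_drop_smallest.
- rewrite addrAC.
  by apply: le_trans gac; apply: le_trans (lerD ha hc); apply: powR_drop_smallest.
- rewrite -addrA addrC.
  by apply: le_trans gbc; apply: le_trans (lerD hb hc); apply: powR_drop_smallest.
Qed.

Lemma nodes_history (k : nat) (w : history k) :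
  nodes (shape (history_tree w)) = k.
Proof.
have sz t : size (inner t) = nodes (shape t).
  by elim: t => //= v a <- b <- c <-; rewrite !size_cat addnA.
by rewrite -sz (perm_size (perm_inner_history w)) size_iota.
Qed.

(** Averaging over the last face is [grow] divided by the face count, the recursion of [mean]. *)
Lemma expect_shape (R : realType) (k : nat) (f : tree -> R) :
  expect (fun w : history k => f (shape (history_tree w))) = mean f k.
Proof.
elim: k f => [|k IHk] f.
  rewrite /expect (big_pred1 tt) /= => [|[]//].
  by rewrite mul1r /mean /odd_prod big_ord0 divr1.
rewrite /expect -(pair_bigA _ (fun (w : history k) (i : 'I_(k.*2.+1)) =>
  prob R w * (size (faces (ran w)))%:R^-1
  * f (shape (expand i k.*2.+1 k.+3 (history_tree w))))) /=.
have k0 : k.*2.+1%:R != 0 :> R by rewrite pnatr_eq0.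
apply: (mulfI k0); rewrite -mean_grow -IHk /expect big_distrr /=.
apply: eq_bigr => w _; rewrite -big_distrr /= size_faces_ran.
rewrite mulrA mulrCA mulfV// mulr1; congr (_ * _).
rewrite -(sum_expand f k.*2.+1 k.+3); last first.
  by rewrite (perm_uniq (perm_leaves_history w)) iota_uniq.
rewrite (perm_big _ (perm_leaves_history w)) /=.
by rewrite -(big_mkord xpredT (fun i => f (shape
  (expand i k.*2.+1 k.+3 (history_tree w))))) /index_iota subn0.
Qed.

(** Write [2n + 1] as the telescoping product of [1 + 2 / (2j + 1)] and bound the power of each
    factor by its tangent. *)
Lemma powR_le_growth (R : realType) (a : R) (n : nat) :
  0 < a < 1 -> n.*2.+1%:R `^ a <= growth (2 * a) n.
Proof.
move=> a01; have a0 : 0 < a by case/andP: a01.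
elim: n => [|n IHn]; first by rewrite powR1 /growth big_ord0.
set m : R := n.*2.+1%:R in IHn *; have m0 : 0 < m by rewrite ltr0n.
have -> : n.+1.*2.+1%:R = m * (1 + 2 / m).
  by rewrite mulrDr mulr1 mulrCA divff ?gt_eqF// mulr1 -natrD; congr (_%:R); lia.
rewrite /growth big_ord_recr /= -/(growth _ _) -/m.
have m2 : 0 <= 1 + 2 / m by rewrite addr_ge0// divr_ge0// ltW.
rewrite powRM ?(ltW m0)// ler_pM ?powR_ge0//.
apply: le_trans (powR_le_tangent a01 m2) _.
by rewrite le_eqVlt; apply/orP; left; apply/eqP; ring.
Qed.

Lemma ler_expect (R : realType) (k : nat) (X Y : history k -> R) :
  (forall w, X w <= Y w) -> expect X <= expect Y.
Proof.
move=> XY; apply: ler_sum => w _; apply: ler_wpM2l => //.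
by elim: k w {X Y XY} => [//|k IHk] w /=; rewrite mulr_ge0.
Qed.

Theorem theorem2 (R : realType) :
  (forall (k : nat) (w : history k),
     (k.*2.+1)%:R `^ (ln 2 / ln 3) + 2 <= (L w)%:R :> R) /\
  (fun k : nat => expect (fun w : history k => (L w)%:R) : R)
    \is 'Omega_\oo (fun k : nat => (k.*2.+1)%:R `^ (88 / 100) : R).
Proof.
split=> [k w|].
  apply: le_trans (_ : (gain (shape (history_tree w)) + 2)%:R <= _).
    by rewrite natrD lerD2r -{1}(nodes_history w) powR_le_gain.
  by rewrite ler_nat L_ge_gain.
have x0 : 0 <= 44 / 25 :> R by rewrite divr_ge0.
have h0 := growth_gt0 80 x0.
(* The constant [1 / h(80)] is the one from [mean_gain_ge] at [N = 80], and the estimates hold for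
   every [k]. *)
rewrite qualifE; apply/asboolP; exists (growth (44 / 25) 80)^-1.
  by rewrite invr_gt0.
near=> k; rewrite [`|_ `^ _|]ger0_norm ?powR_ge0//.
apply: le_trans (ler_norm _).
apply: (@le_trans _ _ (mean (fun t => (gain t)%:R) k)).
  apply: le_trans (mean_gain_ge k x0 (kept_check_sound R _ kept_check80)); last by [].
  rewrite ler_wpM2l ?invr_ge0 ?(ltW h0)//.
  have -> : 44 / 25 = 2 * (88 / 100) :> R by field.
  by apply: powR_le_growth; rewrite divr_gt0//= ltr_pdivrMr// mul1r ltr_nat.
rewrite -expect_shape; apply: ler_expect => w.
by rewrite ler_nat; apply: leq_trans (L_ge_gain w); rewrite leq_addr.
Unshelve. all: by end_near. Qed.
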